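(* Let $n \in \mathbb{N}_0$, let $T$ be an $n$-dimensional simplex with ordered vertices, let $k \in [0:n]$ and let $r \geq 1$ be an integer. Let $$\mathring{\mathcal{P}}_r\Lambda^{k}(T) := \left\{ \omega\in\mathcal{P}_r\Lambda^k(T) \;\middle|\; \operatorname{tr}_{T,F}\omega=0 \text{ for every subsimplex } F\subsetneq T\right\}.$$ Then the set $$\mathcal{B}\mathring{\mathcal{P}}_r\Lambda^{k}(T) := \left\{ \lambda^{\alpha}\, \mathrm{d}\lambda_{\sigma} \;\middle|\; \alpha \in A(r,n),\ \sigma \in \Sigma(k,n),\ \lfloor\alpha\rfloor \notin [\sigma],\ [\alpha]\cup[\sigma]=[0:n] \right\}$$ is a basis of $\mathring{\mathcal{P}}_r\Lambda^{k}(T)$, and the set $$\mathcal{S}\mathring{\mathcal{P}}_r\Lambda^{k}(T) := \left\{ \lambda^{\alpha}\, \mathrm{d}\lambda_{\sigma} \;\middle|\; \alpha \in A(r,n),\ \sigma \in \Sigma(k,n),\ [\alpha]\cup[\sigma]=[0:n] \right\}$$ is a spanning set of $\mathring{\mathcal{P}}_r\Lambda^{k}(T)$.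
   Context: All vector spaces are over $\mathbb{C}$. For integers $a,b$, $[a:b]=\{a,\dots,b\}$ (empty if $a>b$). An $n$-dimensional simplex $T$ is the convex hull of $n+1$ affinely independent points $v_0,\dots,v_n$ (its ordered vertices) in some Euclidean space; a subsimplex of $T$ is the convex hull of a nonempty subset of its vertices. $\Lambda^k(T)$ is the space of (complex-valued) smooth differential $k$-forms on $T$ all of whose coefficients have bounded derivatives of all orders. For a subsimplex $F\subseteq T$, the trace $\operatorname{tr}_{T,F}:\Lambda^k(T)\to\Lambda^k(F)$ is the pullback along the inclusion $F\to T$. The barycentric coordinates $\lambda_0,\dots,\lambda_n$ are the affine functions on $T$ with $\lambda_i(v_j)=\delta_{ij}$, and $\mathrm{d}\lambda_i \in \Lambda^1(T)$ are their exterior derivatives. $A(r,n)$ is the set of maps $\alpha:[0:n]\to\mathbb{N}_0$ with $|\alpha|:=\sum_{i=0}^n\alpha(i)=r$; $[\alpha]=\{i\in[0:n] : \alpha(i)>0\}$; $\lfloor\alpha\rfloor$ is the minimal element of $[\alpha]$ (and $\infty$ if $[\alpha]=\emptyset$); $\lambda^\alpha=\prod_{i=0}^n\lambda_i^{\alpha(i)}$. $\Sigma(k,n)$ is the set of strictly increasing maps $\sigma:[1:k]\to[0:n]$ (with $\Sigma(0,n)=\{\emptyset\}$); $[\sigma]$ is the image of $\sigma$; $\mathrm{d}\lambda_\sigma=\mathrm{d}\lambda_{\sigma(1)}\wedge\dots\wedge \mathrm{d}\lambda_{\sigma(k)}$, with $\mathrm{d}\lambda_\emptyset=1$. $\mathcal{P}_r\Lambda^k(T):=\operatorname{span}\{\lambda^\alpha\,\mathrm{d}\lambda_\sigma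 : \alpha\in A(r,n),\ \sigma\in\Sigma(k,n)\}$. *)

(* Defs.v *)
From HB Require Import structures.
From mathcomp Require Import all_boot all_order all_algebra perm.
From mathcomp Require Import boolp classical_sets functions reals normedtype.
From mathcomp Require Import complex ring.

Set Implicit Arguments.
Unset Strict Implicit.
Unset Printing Implicit Defensive.
Import Order.TTheory GRing.Theory Num.Theory.
Import numFieldNormedType.Exports.
Local Open Scope classical_set_scope.
Local Open Scope complex_scope.
Local Open Scope ring_scope.

Section LinearAlgebra.
Variables (K : pzRingType) (V : lmodType K).
Implicit Types A W : set V.

Definition lin_span A : set V :=
  [set w | exists m (b : 'I_m -> V) (c : 'I_m -> K),
     (forall i, A (b i)) /\ w = \sum_i c i *: b i].

Definition linearly_independent A : Prop :=
  forall m (b : 'I_m -> V) (c : 'I_m -> K), injective b ->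
    (forall i, A (b i)) -> \sum_i c i *: b i = 0 -> forall i, c i = 0.

Definition spanning_set A W : Prop := lin_span A = W.

Definition is_basis A W : Prop := linearly_independent A /\ spanning_set A W.

End LinearAlgebra.

Section Simplex.
Variables (R : realType) (d : nat).

Definition affinely_independent n (v : 'I_n.+1 -> 'rV[R]_d) : Prop :=
  forall c : 'I_n.+1 -> R,
    \sum_i c i = 0 -> \sum_i c i *: v i = 0 -> forall i, c i = 0.

(* A simplex is given by its ordered vertices. *)
Record simplex n := Simplex {
  vertex :> 'I_n.+1 -> 'rV[R]_d;
  vertex_indep : affinely_independent vertex }.

Definition hull n (T : simplex n) : set 'rV[R]_d :=
  [set x | exists c : 'I_n.+1 -> R,
     [/\ forall i, 0 <= c i, \sum_i c i = 1 & x = \sum_i c i *: T i]].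

(* The common tangent space of T at all of its points: the direction of the
   affine hull of T. *)
Definition tangent n (T : simplex n) : {vspace 'rV[R]_d} :=
  <<[seq T i - T j | i <- enum 'I_n.+1, j <- enum 'I_n.+1]>>%VS.

Definition tvec n (T : simplex n) := subvs_of (tangent T).

Definition subsimplex m n (F : simplex m) (T : simplex n) : Prop :=
  forall i, exists j, F i = T j.

Lemma hull_vertex n (T : simplex n) i : hull T (T i).
Proof.
exists (fun j => (j == i)%:R); split=> [j||].
- by case: eqP.
- by rewrite (bigD1 i) //= eqxx big1 ?addr0 // => j /negPf->.
- by rewrite (bigD1 i) //= eqxx scale1r big1 ?addr0 // => j /negPf->; rewrite scale0r.
Qed.

Definition vertex_point n (T : simplex n) i : hull T :=
  SigSub (mem_set (hull_vertex T i)).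

Lemma subsimplex_hull m n (F : simplex m) (T : simplex n) :
  subsimplex F T -> hull F `<=` hull T.
Proof.
move=> /choice[h hE] x [c [c0 c1 ->]].
exists (fun j => \sum_(i | h i == j) c i); split=> [j||].
- exact: sumr_ge0.
- by rewrite -c1 [RHS](partition_big h predT).
- rewrite (partition_big h predT) //=; apply: eq_bigr => j _.
  by rewrite scaler_suml; apply: eq_bigr => i /eqP<-; rewrite hE.
Qed.

Lemma tangent_vertex n (T : simplex n) i j : T i - T j \in tangent T.
Proof.
by apply/memv_span/allpairsP; exists (i, j); rewrite !mem_enum.
Qed.

Lemma subsimplex_tangent m n (F : simplex m) (T : simplex n) :
  subsimplex F T -> (tangent F <= tangent T)%VS.
Proof.
move=> sFT; apply/span_subvP => _ /allpairsP[[i j] [_ _ ->]] /=.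
by have [i' ->] := sFT i; have [j' ->] := sFT j; exact: tangent_vertex.
Qed.

Lemma hull_sub_tangent n (T : simplex n) (x y : hull T) :
  val y - val x \in tangent T.
Proof.
suff h (z : hull T) : val z - T ord0 \in tangent T.
  rewrite -[val y](subrK (T ord0)) -addrA -[_ - val x]opprB.
  exact: memvB.
have [c [_ c1 ->]] := set_valP z.
rewrite -[T ord0]scale1r -c1 scaler_suml -sumrB memv_suml // => i _.
by rewrite -scalerBr memvZ // tangent_vertex.
Qed.

(* The inclusion of F into T on points, and its derivative on tangent
   vectors. *)
Definition incl_point m n (F : simplex m) (T : simplex n)
    (sFT : subsimplex F T) (x : hull F) : hull T :=
  SigSub (mem_set (subsimplex_hull sFT (set_valP x))).

Definition incl_vec m n (F : simplex m) (T : simplex n)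
    (sFT : subsimplex F T) (t : tvec F) : tvec T :=
  Subvs (subvP (subsimplex_tangent sFT) _ (subvsP t)).

End Simplex.

Section Smooth.
Variables (R : realType) (d n : nat) (T : simplex R d n).
Implicit Types (f g : hull T -> R[i]) (x y : hull T) (L : tvec T -> R[i]).

Definition real_linear L : Prop :=
  forall (a : R) s t, L (a *: s + t) = a%:C * L s + L t.

(* Total differential relative to the closed set T: y ranges over points of T
   only, so that this also makes sense on the boundary, where it is the
   continuous extension of the interior differential for the functions
   considered below. *)
Definition is_differential f x L : Prop :=
  real_linear L /\
  forall e : R, 0 < e -> exists2 r : R, 0 < r &
    forall y, `|val y - val x| <= r ->
      `|f y - f x - L (vsproj (tangent T) (val y - val x))|
        <= (e * `|val y - val x|)%:C.

Fixpoint bounded_derivatives (m : nat) f : Prop :=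
  (exists M : R, forall x, `|f x| <= M%:C) /\
  if m is m'.+1 then
    exists D : hull T -> tvec T -> R[i],
      (forall x, is_differential f x (D x)) /\
      (forall t, bounded_derivatives m' (D ^~ t))
  else True.

Definition smooth f : Prop := forall m, bounded_derivatives m f.

(* Meaningful only if f is differentiable at x. *)
Definition differential f x : tvec T -> R[i] :=
  xget (fun=> 0) [set L | is_differential f x L].

Definition multilinear k (w : ('I_k -> tvec T) -> R[i]) : Prop :=
  forall (t : 'I_k -> tvec T) i (a : R) u v,
    w (fun j => if j == i then a *: u + v else t j) =
    a%:C * w (fun j => if j == i then u else t j)
    + w (fun j => if j == i then v else t j).

Definition alternating k (w : ('I_k -> tvec T) -> R[i]) : Prop :=
  forall (t : 'I_k -> tvec T) i j, i != j -> t i = t j -> w t = 0.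

(* Evaluating on constant tangent vectors yields the coefficients. *)
Definition is_form k : {pred (hull T -> ('I_k -> tvec T) -> R[i])} :=
  fun w => `[< [/\ forall x, multilinear (w x), forall x, alternating (w x)
                 & forall t, smooth (w ^~ t)] >].

Lemma real_linear0 L : real_linear L -> L 0 = 0.
Proof. by move=> /(_ (-1) 0 0); rewrite scaler0 addr0 rmorphN1 mulN1r addNr. Qed.

Lemma real_linearD L s t : real_linear L -> L (s + t) = L s + L t.
Proof. by move=> /(_ 1 s t); rewrite scale1r rmorph1 mul1r. Qed.

Lemma real_linearZ L (a : R) s : real_linear L -> L (a *: s) = a%:C * L s.
Proof. by move=> Ll; have := Ll a s 0; rewrite !addr0 real_linear0 // addr0. Qed.

Lemma real_linear_sum L I (r : seq I) (F : I -> tvec T) : real_linear L ->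
  L (\sum_(i <- r) F i) = \sum_(i <- r) L (F i).
Proof.
move=> Ll; elim: r => [|i r IH]; first by rewrite !big_nil real_linear0.
by rewrite !big_cons real_linearD // IH.
Qed.

Lemma realcD (a b : R) : (a + b)%:C = a%:C + b%:C.
Proof. exact: rmorphD. Qed.

Lemma realcM (a b : R) : (a * b)%:C = a%:C * b%:C.
Proof. exact: rmorphM. Qed.

Lemma normcR (z : R[i]) : exists2 a : R, 0 <= a & `|z| = a%:C.
Proof. by rewrite normc_def; eexists; last by []; rewrite sqrtr_ge0. Qed.

Lemma normrC (a : R) : `|a%:C| = `|a|%:C.
Proof. by rewrite normc_def /= expr0n addr0 sqrtr_sqr. Qed.

Lemma real_linear_bounded L : real_linear L ->
  exists2 M : R, 0 <= M & forall u, `|L (vsproj (tangent T) u)| <= (M * `|u|)%:C.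
Proof.
move=> Ll.
have /choice[b bP] j : exists a : R,
    0 <= a /\ `|L (vsproj (tangent T) (delta_mx 0 j))| = a%:C.
  by have [a a0 aE] := normcR (L (vsproj (tangent T) (delta_mx 0 j))); exists a.
exists (\sum_j b j) => [|u]; first by apply: sumr_ge0 => j _; case: (bP j).
rewrite [u in vsproj _ u]row_sum_delta linear_sum real_linear_sum //.
apply: le_trans (ler_norm_sum _ _ _) _.
rewrite mulr_suml rmorph_sum; apply: ler_sum => j _.
have [b0 bE] := bP j.
rewrite linearZ real_linearZ // normrM bE normrC -realcM lecR mulrC.
rewrite ler_wpM2l // [leRHS]/Num.norm /= mx_normrE.
by apply/le_trans/(le_bigmax _ (fun ij => `|u ij.1 ij.2|) (0, j)).
Qed.

Lemma is_differential_cst (c : R[i]) x : is_differential (fun=> c) x (fun=> 0).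
Proof.
split=> [a s t|e e0]; first by rewrite mulr0 addr0.
by exists 1 => // y _; rewrite subrr subr0 normr0 ler0c mulr_ge0 // ltW.
Qed.

Lemma is_differentialD f g x L L' :
  is_differential f x L -> is_differential g x L' ->
  is_differential (fun y => f y + g y) x (fun t => L t + L' t).
Proof.
move=> [Ll Lf] [Ll' Lg]; split=> [a s t|e e0].
  by rewrite Ll Ll' mulrDr addrACA.
have e20 : 0 < e / 2 by rewrite divr_gt0.
have [r r0 rP] := Lf _ e20; have [r' r'0 r'P] := Lg _ e20.
exists (Num.min r r') => [|y]; first by rewrite lt_min r0.
rewrite le_min => /andP[/rP h /r'P h'].
rewrite [e in e * _](splitr e) mulrDl realcD.
apply: le_trans (le_trans (ler_normD _ _) (lerD h h')).
set u := vsproj _ _; rewrite [X in `|X| <= _](_ : _ = (f y - f x - L u) + (g y - g x - L' u)) //; ring.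
Qed.

Lemma is_differentialM f g x L L' :
  is_differential f x L -> is_differential g x L' ->
  is_differential (fun y => f y * g y) x (fun t => L t * g x + f x * L' t).
Proof.
move=> [Ll Lf] [Ll' Lg]; split=> [a s t|e e0].
  by rewrite Ll Ll'; ring.
have [K K0 KP] := real_linear_bounded Ll.
have [K' K'0 K'P] := real_linear_bounded Ll'.
have [A A0 AE] := normcR (f x); have [B B0 BE] := normcR (g x).
pose eta := Num.min 1 (e / 2 / (A + B + 1)).
have AB0 : 0 < A + B + 1 by rewrite ltr_wpDl // addr_ge0.
have eta0 : 0 < eta by rewrite lt_min ltr01 !divr_gt0.
have eta1 : eta <= 1 by rewrite ge_min lexx.
have etaAB : (A + B) * eta <= e / 2.
  apply: (@le_trans _ _ ((A + B + 1) * (e / 2 / (A + B + 1)))).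
    by apply: ler_pM; rewrite ?addr_ge0 ?lerDl ?ler01 ?(ltW eta0) // ge_min lexx orbT.
  by rewrite mulrC divfK // gt_eqF.
have [r r0 rP] := Lf _ eta0; have [r' r'0 r'P] := Lg _ eta0.
have KK0 : 0 < (K + 1) * (K' + 1) by rewrite mulr_gt0 // ltr_wpDl.
exists (Num.min (Num.min r r') (e / 2 / ((K + 1) * (K' + 1)))) => [|y].
  by rewrite !lt_min r0 r'0 !divr_gt0.
rewrite !le_min => /andP[/andP[/rP h /r'P h'] hy].
set N := `|val y - val x| in hy h h' *.
have N0 : 0 <= N by exact: normr_ge0.
have := KP (val y - val x); have := K'P (val y - val x).
set l := L _ in h *; set l' := L' _ in h' *; rewrite -/N => kl' kl.
set p := f y - f x - l in h; set q := g y - g x - l' in h'.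
have -> : f y * g y - f x * g x - (l * g x + f x * l') =
    f x * q + g x * p + (p + l) * (q + l') by rewrite /p /q; ring.
apply: (@le_trans _ _ (A * (eta * N) + B * (eta * N) +
     (eta * N + K * N) * (eta * N + K' * N))%:C).
  rewrite !realcD (realcM A) (realcM B) (realcM (_ + _)) -AE -BE.
  apply: le_trans (ler_normD _ _) (lerD _ _).
    apply: le_trans (ler_normD _ _) (lerD _ _);
    by rewrite normrM ler_wpM2l.
  rewrite normrM; apply: ler_pM => //.
    by apply: le_trans (ler_normD _ _) _; rewrite realcD lerD.
  by apply: le_trans (ler_normD _ _) _; rewrite realcD lerD.
rewrite lecR [e in leRHS](splitr e) [leRHS]mulrDl lerD //.
  by rewrite -mulrDl mulrA ler_wpM2r.
have -> : (eta * N + K * N) * (eta * N + K' * N) =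
  ((K + eta) * (K' + eta) * N) * N by ring.
rewrite ler_wpM2r //.
apply: (@le_trans _ _ ((K + 1) * (K' + 1) * N)).
  rewrite ler_wpM2r // ler_pM ?addr_ge0 ?(ltW eta0) // lerD2l //.
apply: le_trans (ler_wpM2l (ltW KK0) hy) _.
by rewrite mulrC divfK // gt_eqF.
Qed.

Lemma hull_segment x y (s : R) : 0 <= s <= 1 ->
  exists z : hull T, val z = val x + s *: (val y - val x).
Proof.
move=> /andP[s0 s1].
suff h : hull T (val x + s *: (val y - val x)) by exists (SigSub (mem_set h)).
have [c [c0 c1 ->]] := set_valP x; have [b [b0 b1 ->]] := set_valP y.
exists (fun i => (1 - s) * c i + s * b i); split=> [i||].
- by rewrite addr_ge0 // mulr_ge0 // subr_ge0.
- by rewrite big_split /= -!mulr_sumr b1 c1 !mulr1 subrK.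
- under [in RHS]eq_bigr do rewrite scalerDl -!scalerA.
  by rewrite big_split /= -!scaler_sumr scalerBl scalerBr scale1r addrAC addrA.
Qed.

Lemma is_differential_unique f x L L' :
  is_differential f x L -> is_differential f x L' -> L = L'.
Proof.
move=> dL dL'.
have [Nl NP] := is_differentialD dL
  (is_differentialM (is_differential_cst (-1) x) dL').
set N := fun t => _ in Nl NP.
have Nz (z : hull T) : N (vsproj (tangent T) (val z - val x)) = 0.
  set h := val z - val x.
  have [a a0 aE] := normcR (N (vsproj (tangent T) h)).
  suff a00 : a <= 0.
    by apply/eqP; rewrite -normr_eq0 aE eq_le ler0c a0 andbT lecR.
  apply/ler_addgt0Pr => e e0; rewrite add0r.
  have h10 : 0 < `|h| + 1 by rewrite ltr_wpDl.
  have [r r0 rP] := NP _ (divr_gt0 e0 h10).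
  pose s := Num.min 1 (r / (`|h| + 1)).
  have s0 : 0 < s by rewrite lt_min ltr01 divr_gt0.
  have s01 : 0 <= s <= 1 by rewrite (ltW s0) ge_min lexx.
  have [y yE] := hull_segment x z s01.
  have yx : val y - val x = s *: h by rewrite yE addrC addKr.
  have := rP y; rewrite yx normrZ gtr0_norm //.
  have sr : s * `|h| <= r.
    apply: (@le_trans _ _ (r / (`|h| + 1) * (`|h| + 1))).
      by rewrite ler_pM // ?(ltW s0) ?lerDl // ge_min lexx orbT.
    by rewrite divfK // gt_eqF.
  move=> /(_ sr); rewrite -/(N _) !mulN1r !subrr sub0r normrN linearZ.
  rewrite real_linearZ // normrM aE normrC gtr0_norm // -realcM lecR.
  rewrite mulrCA ler_pM2l // => /le_trans; apply.
  by rewrite mulrAC ler_pdivrMr // ler_wpM2l ?(ltW e0) // lerDl.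
suff N0 t : N t = 0.
  by apply/funext => t; apply/eqP; rewrite -subr_eq0 -(N0 t) /N mul0r add0r mulN1r.
have Nij i j : N (vsproj (tangent T) (T i - T j)) = 0.
  have -> : T i - T j = (T i - val x) - (T j - val x) by rewrite opprB addrA subrK.
  rewrite linearB -[- vsproj _ _]scaleN1r addrC.
  rewrite Nl (Nz (vertex_point T i)) (Nz (vertex_point T j)).
  by rewrite mulr0 addr0.
rewrite -[t]vsvalK.
have /(@coord_span _ _ _ (in_tuple _)) -> := subvsP t.
rewrite linear_sum real_linear_sum // big1 // => i _.
rewrite linearZ real_linearZ //.
have /allpairsP[[a b] [_ _ ->]] : (in_tuple [seq T i - T j | i <- enum 'I_n.+1, j <- enum 'I_n.+1])`_i \in [seq T i - T j | i <- enum 'I_n.+1, j <- enum 'I_n.+1] by apply: mem_nth.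
by rewrite Nij mulr0.
Qed.

Lemma bounded_derivativesW m f :
  bounded_derivatives m.+1 f -> bounded_derivatives m f.
Proof.
elim: m f => [|m IH] f [fb [D [Df Db]]] //=.
by split=> //; exists D; split=> // t; apply/IH/Db.
Qed.

Lemma smooth_cst (c : R[i]) : smooth (fun=> c).
Proof.
move=> m; elim: m c => [|m IH] c; split.
- by have [a _ aE] := normcR c; exists a => x; rewrite aE.
- by [].
- by have [a _ aE] := normcR c; exists a => x; rewrite aE.
- exists (fun=> fun=> 0); split=> [x|_]; last exact: IH.
  exact: is_differential_cst.
Qed.

Lemma bounded_derivativesD m f g :
  bounded_derivatives m f -> bounded_derivatives m g ->
  bounded_derivatives m (fun x => f x + g x).
Proof.
elim: m f g => [|m IH] f g [[M fM] fD] [[M' gM] gD].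
all: split; [exists (M + M') => x; rewrite realcD;
  exact: le_trans (ler_normD _ _) (lerD _ _)|].
  by [].
have [D [Df Db]] := fD; have [D' [Dg Db']] := gD.
exists (fun x t => D x t + D' x t); split=> [x|t].
2: exact: (IH _ _ (Db t) (Db' t)).
exact: is_differentialD.
Qed.

Lemma smoothD f g : smooth f -> smooth g -> smooth (fun x => f x + g x).
Proof. by move=> fs gs m; exact: bounded_derivativesD. Qed.

Lemma smoothM f g : smooth f -> smooth g -> smooth (fun x => f x * g x).
Proof.
move=> fs gs m; move: (fs m) (gs m) => {fs gs}.
elim: m f g => [|m IH] f g fm gm.
all: have [[M fM] fD] := fm; have [[M' gM] gD] := gm.
all: split; [by exists (M * M') => x; rewrite realcM normrM ler_pM|].
  by [].
have [f0 g0] := (bounded_derivativesW fm, bounded_derivativesW gm).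
have [D [Df Db]] := fD; have [D' [Dg Db']] := gD.
exists (fun x t => D x t * g x + f x * D' x t); split=> [x|t].
  exact: is_differentialM.
apply: (@bounded_derivativesD m (fun x => D x t * g x) (fun x => f x * D' x t)).
  exact: (IH _ _ (Db t) g0).
exact: (IH _ _ f0 (Db' t)).
Qed.

Lemma smooth_sum I (r : seq I) (F : I -> hull T -> R[i]) :
  (forall i, smooth (F i)) -> smooth (fun x => \sum_(i <- r) F i x).
Proof.
move=> Fs; elim: r => [|i r IH].
  rewrite [X in smooth X](_ : _ = fun=> 0); first exact: smooth_cst.
  by apply/funext => x; rewrite big_nil.
rewrite [X in smooth X](_ : _ = fun x => F i x + \sum_(j <- r) F j x).
  exact: smoothD.
by apply/funext => x; rewrite big_cons.
Qed.

Lemma smooth_prod I (r : seq I) (F : I -> hull T -> R[i]) :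
  (forall i, smooth (F i)) -> smooth (fun x => \prod_(i <- r) F i x).
Proof.
move=> Fs; elim: r => [|i r IH].
  rewrite [X in smooth X](_ : _ = fun=> 1); first exact: smooth_cst.
  by apply/funext => x; rewrite big_nil.
rewrite [X in smooth X](_ : _ = fun x => F i x * \prod_(j <- r) F j x).
  exact: smoothM.
by apply/funext => x; rewrite big_cons.
Qed.

Lemma smoothX f k : smooth f -> smooth (fun x => f x ^+ k).
Proof.
move=> fs; elim: k => [|k IH]; first exact: smooth_cst.
rewrite [X in smooth X](_ : _ = fun x => f x * f x ^+ k).
  exact: smoothM.
by apply/funext => x; rewrite exprS.
Qed.

Lemma differentialP f x : smooth f -> is_differential f x (differential f x).
Proof.
move=> /(_ 1) [_ [D [Df _]]]; apply: (xgetPex (fun=> 0)).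
by exists (D x); exact: Df.
Qed.

Lemma smooth_differential f t : smooth f -> smooth (fun x => differential f x t).
Proof.
move=> fs m; have [_ [D [Df Db]]] := fs m.+1.
rewrite [X in bounded_derivatives _ X](_ : _ = D ^~ t); first exact: Db.
apply/funext => x; congr (_ t).
by apply: is_differential_unique (Df x); exact: differentialP.
Qed.

Lemma is_form_submod k : submod_closed (@is_form k).
Proof.
split=> [|a w w' /asboolP[wm wa ws] /asboolP[wm' wa' ws']]; apply/asboolP.
  split=> [x t i a u v|//|t]; last exact: smooth_cst.
  by rewrite mulr0 addr0.
split=> [x t i b u v|x t i j ij tij|t].
- rewrite /= !fctE /= wm wm'.
  by rewrite /GRing.scale /=; ring.
- by rewrite !fctE /= (wa x t i j) // (wa' x t i j) // scaler0 addr0.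
- by apply: smoothD => //; apply: smoothM => //; exact: smooth_cst.
Qed.

HB.instance Definition _ k :=
  GRing.isSubmodClosed.Build _ _ (@is_form k) (@is_form_submod k).

Record diff_form k := DiffForm {
  diff_form_val :> hull T -> ('I_k -> tvec T) -> R[i];
  _ : diff_form_val \in @is_form k }.

HB.instance Definition _ k := [isSub for @diff_form_val k].
HB.instance Definition _ k := [Choice of diff_form k by <:].
HB.instance Definition _ k := [SubChoice_isSubLmodule of diff_form k by <:].

Record sfun := Sfun {
  sfun_val :> hull T -> R[i];
  sfun_smooth : smooth sfun_val }.

End Smooth.

Section Trace.
Variables (R : realType) (d m n k : nat).
Variables (F : simplex R d m) (T : simplex R d n) (sFT : subsimplex F T).

Definition pullback (w : hull T -> ('I_k -> tvec T) -> R[i]) :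
    hull F -> ('I_k -> tvec F) -> R[i] :=
  fun x t => w (incl_point sFT x) (fun i => incl_vec sFT (t i)).

Lemma incl_vec_linear (a : R) s t :
  incl_vec sFT (a *: s + t) = a *: incl_vec sFT s + incl_vec sFT t.
Proof. exact: val_inj. Qed.

Lemma smooth_incl (f : hull T -> R[i]) :
  smooth f -> smooth (f \o incl_point sFT).
Proof.
move=> fs p; move: (fs p) => {fs}.
elim: p f => [|p IH] f [[M fM] fD].
  by split=> //; exists M => x; exact: fM.
split; first by exists M => x; exact: fM.
have [D [Df Db]] := fD.
exists (fun x t => D (incl_point sFT x) (incl_vec sFT t)); split=> [x|t].
  2: exact: (IH _ (Db _)).
have [Dl DP] := Df (incl_point sFT x).
split=> [a s t|e e0]; first by rewrite incl_vec_linear Dl.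
have [r r0 rP] := DP _ e0; exists r => // y yx.
have := rP (incl_point sFT y) yx.
congr (`|_ - D _ _| <= _); apply: val_inj.
have h : val y - val x \in tangent F by exact: hull_sub_tangent.
by rewrite [LHS]vsprojK ?(subvP (subsimplex_tangent sFT)) //= vsprojK.
Qed.

Lemma pullback_form (w : diff_form T k) : pullback w \in @is_form _ _ _ F k.
Proof.
have /asboolP[wm wa ws] := valP w; apply/asboolP; split=> [x t i a u v|x t i j ij tij|t].
- rewrite /pullback.
  have incl_if z : (fun j => incl_vec sFT (if j == i then z else t j)) =
      fun j => if j == i then incl_vec sFT z else incl_vec sFT (t j).
    by apply/funext => j; case: ifP.
  by rewrite !incl_if incl_vec_linear wm.
- by apply: (wa _ _ i j) => //; rewrite tij.
- exact: (smooth_incl (ws (fun i => incl_vec sFT (t i)))).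
Qed.

Definition tr (w : diff_form T k) : diff_form F k := DiffForm (pullback_form w).

End Trace.

Section Barycentric.
Variables (R : realType) (d n : nat) (T : simplex R d n).

Definition affine (f : hull T -> R) : Prop :=
  forall m (c : 'I_m -> R) (x : 'I_m -> hull T) (y : hull T),
    \sum_i c i = 1 -> val y = \sum_i c i *: val (x i) ->
    f y = \sum_i c i * f (x i).

(* The affine functions taking the value delta_ij at the j-th vertex; existence
   and uniqueness are barycentricP and barycentric_unique below. *)
Definition barycentric (i : 'I_n.+1) : hull T -> R :=
  xget (fun=> 0)
    [set f | affine f /\ forall j, f (vertex_point T j) = (i == j)%:R].

Lemma vertex_coords_unique (c b : 'I_n.+1 -> R) :
  \sum_i c i = \sum_i b i -> \sum_i c i *: T i = \sum_i b i *: T i -> c = b.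
Proof.
move=> cb cbT; apply/funext => i; apply/eqP; rewrite -subr_eq0; apply/eqP.
apply: (vertex_indep (s := T) (c := fun i => c i - b i)).
  by rewrite sumrB cb subrr.
by under eq_bigr do rewrite scalerBl; rewrite sumrB cbT subrr.
Qed.

Lemma barycentric_exists i :
  exists f, affine f /\ forall j, f (vertex_point T j) = (i == j)%:R.
Proof.
have /choice[c cP] (x : hull T) : exists c : 'I_n.+1 -> R,
    \sum_i c i = 1 /\ val x = \sum_i c i *: T i.
  by have [c [_ c1 cE]] := set_valP x; exists c.
exists (fun x => c x i); split=> [m b x y b1 yE|j].
  rewrite (@vertex_coords_unique (c y) (fun i => \sum_j b j * c (x j) i)) //.
    have [-> _] := cP y; rewrite exchange_big /= -b1.
    by apply: eq_bigr => j _; rewrite -mulr_sumr (cP _).1 mulr1.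
  have [_ <-] := cP y; rewrite yE.
  under [RHS]eq_bigr do rewrite scaler_suml.
  rewrite exchange_big /=; apply: eq_bigr => j _.
  rewrite (cP (x j)).2 scaler_sumr.
  by apply: eq_bigr => l _; rewrite scalerA.
rewrite (@vertex_coords_unique (c (vertex_point T j)) (fun i => (i == j)%:R)) //.
  rewrite (cP _).1 (bigD1 j) //= eqxx big1 ?addr0 // => l /negPf->.
  by [].
rewrite -(cP _).2 /= (bigD1 j) //= eqxx scale1r big1 ?addr0 // => l /negPf->.
by rewrite scale0r.
Qed.

Lemma barycentricP i : affine (barycentric i) /\
  forall j, barycentric i (vertex_point T j) = (i == j)%:R.
Proof. exact: (xgetPex (fun=> 0) (barycentric_exists i)). Qed.

Lemma affine_coords f (c : 'I_n.+1 -> R) (x : hull T) :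
  affine f -> \sum_i c i = 1 -> val x = \sum_i c i *: T i ->
  f x = \sum_i c i * f (vertex_point T i).
Proof. by move=> fa c1 xE; apply: fa. Qed.

Lemma barycentric_unique i (f : hull T -> R) : affine f ->
  (forall j, f (vertex_point T j) = (i == j)%:R) -> f = barycentric i.
Proof.
move=> fa fv; have [ba bv] := barycentricP i.
apply/funext => x; have [c [_ c1 xE]] := set_valP x.
rewrite (affine_coords fa c1 xE) (affine_coords ba c1 xE).
by apply: eq_bigr => j _; rewrite fv bv.
Qed.

Lemma barycentricE i (c : 'I_n.+1 -> R) (x : hull T) :
  \sum_i c i = 1 -> val x = \sum_i c i *: T i -> barycentric i x = c i.
Proof.
move=> c1 xE; have [ba bv] := barycentricP i.
rewrite (affine_coords ba c1 xE) (bigD1 i) //= bv eqxx mulr1.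
by rewrite big1 ?addr0 // => j /negPf ji; rewrite bv eq_sym ji mulr0.
Qed.

Lemma barycentric_bounds i (x : hull T) : 0 <= barycentric i x <= 1.
Proof.
have [c [c0 c1 xE]] := set_valP x; rewrite (barycentricE i c1 xE) c0 /=.
by rewrite -c1 (bigD1 i) //= lerDl sumr_ge0.
Qed.

Lemma tangent_coords (t : tvec T) : exists c : 'I_n.+1 -> R,
  \sum_i c i = 0 /\ vsval t = \sum_i c i *: T i.
Proof.
rewrite (@coord_span _ _ _ (in_tuple _) _ (subvsP t)).
elim/big_ind: _ => [|u v [c [c0 ->]] [b [b0 ->]]|i _].
- by exists (fun=> 0); split; [rewrite big1|rewrite big1 // => i _; rewrite scale0r].
- exists (fun i => c i + b i); rewrite big_split /= c0 b0 addr0; split=> //.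
  by rewrite -big_split; apply: eq_bigr => i _; rewrite scalerDl.
set a := coord _ _ _.
set s := in_tuple _.
have /allpairsP[[j l] [_ _ ->]] : s`_i \in s by apply: mem_nth.
exists (fun i => a * ((i == j)%:R - (i == l)%:R)); split=> /=.
  rewrite -mulr_sumr sumrB (bigD1 j) //= eqxx big1 => [|p /negPf-> //].
  by rewrite (bigD1 l) //= eqxx big1 ?addr0 ?subrr ?mulr0 // => p /negPf->.
under eq_bigr do rewrite -scalerA scalerBl.
rewrite -scaler_sumr sumrB; congr (_ *: (_ - _)).
  rewrite (bigD1 j) //= eqxx scale1r big1 ?addr0 // => p /negPf->.
  by rewrite scale0r.
rewrite (bigD1 l) //= eqxx scale1r big1 ?addr0 // => p /negPf->.
by rewrite scale0r.
Qed.

Lemma barycentric_differential i : exists l : tvec T -> R,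
  (forall (a : R) s t, l (a *: s + t) = a * l s + l t) /\
  forall x y : hull T, barycentric i y - barycentric i x =
    l (vsproj (tangent T) (val y - val x)).
Proof.
have /choice[c cP] := tangent_coords.
exists (fun t => c t i); split=> [a s t|x y].
  rewrite (@vertex_coords_unique (c (a *: s + t)) (fun i => a * c s i + c t i)) //.
    by rewrite (cP _).1 big_split /= -mulr_sumr !(cP _).1 mulr0 addr0.
  rewrite -(cP _).2; transitivity (a *: vsval s + vsval t) => //.
  rewrite (cP s).2 (cP t).2 scaler_sumr -big_split /=.
  by apply: eq_bigr => j _; rewrite scalerDl scalerA.
have [b [_ b1 xE]] := set_valP x; have [b' [_ b'1 yE]] := set_valP y.
rewrite (barycentricE i b1 xE) (barycentricE i b'1 yE).
rewrite (@vertex_coords_unique (c _) (fun i => b' i - b i)) //.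
  by rewrite (cP _).1 sumrB b1 b'1 subrr.
rewrite -(cP _).2 /= vsprojK ?hull_sub_tangent // xE yE -sumrB.
by apply: eq_bigr => j _; rewrite scalerBl.
Qed.

Lemma smooth_barycentric i : smooth (fun x => (barycentric i x)%:C).
Proof.
have bb : exists M : R, forall x, `|(barycentric i x)%:C| <= M%:C.
  exists 1 => x; have /andP[b0 b1] := barycentric_bounds i x.
  by rewrite normrC lecR ger0_norm.
have [l [ll lP]] := barycentric_differential i.
case=> [|m]; split=> //; exists (fun _ t => (l t)%:C); split=> [x|t].
  split=> [a s t|e e0]; first by rewrite ll realcD realcM.
  exists 1 => // y _; rewrite -lP rmorphB subrr normr0 ler0c.
  by rewrite mulr_ge0 // ltW.
exact: smooth_cst.
Qed.

End Barycentric.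

Section Monomials.
Variables (R : realType) (d n : nat) (T : simplex R d n).

Definition lambda (i : 'I_n.+1) : sfun T := Sfun (smooth_barycentric T i).

Lemma extd_form (f : sfun T) :
  (fun x (t : 'I_1 -> tvec T) => differential f x (t ord0)) \in @is_form _ _ _ T 1.
Proof.
apply/asboolP; split=> [x t i a u v|x t i j|t].
- rewrite !(ord1 i) eqxx.
  by have [Dl _] := differentialP x (sfun_smooth f); rewrite Dl.
- by rewrite !ord1 eqxx.
- exact: smooth_differential (sfun_smooth f).
Qed.

(* Exterior derivative of a 0-form. *)
Definition extd (f : sfun T) : diff_form T 1 := DiffForm (extd_form f).

Lemma wedge_form k (e : 'I_k -> diff_form T 1) :
  (fun x (t : 'I_k -> tvec T) =>
     \det (\matrix_(i, j) e i x (fun=> t j))) \in @is_form _ _ _ T k.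
Proof.
have eP i := asboolW (valP (e i)).
apply/asboolP; split=> [x t j0 a u v|x t i j ij tij|t].
- rewrite -!(det_tr (\matrix_(i, j) _)).
  rewrite -[X in _ = _ + X]mul1r; apply: (determinant_multilinear (i0 := j0)).
  + apply/rowP => i; rewrite !mxE eqxx.
    have [em _ _] := eP i.
    have := em x (fun=> u) ord0 a u v.
    have ifE w : (fun j : 'I_1 => if j == ord0 then w else u) = fun=> w.
      by apply/funext => j; rewrite ord1.
    by rewrite !ifE mul1r.
  + by apply/matrixP => j i; rewrite !mxE eq_sym (negPf (neq_lift _ _)).
  + by apply/matrixP => j i; rewrite !mxE eq_sym (negPf (neq_lift _ _)).
- rewrite -det_tr; apply: (determinant_alternate ij) => l.
  by rewrite !mxE tij.
- rewrite /determinant.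
  apply: smooth_sum => s; apply: smoothM; first exact: smooth_cst.
  rewrite [X in smooth X](_ : _ = fun x => \prod_i e i x (fun=> t (s i))).
    by apply: smooth_prod => i; have [_ _] := eP i; apply.
  by apply/funext => x; apply: eq_bigr => i _; rewrite mxE.
Qed.

(* Exterior product of 1-forms, normalized so that
   (e_1 /\ ... /\ e_k)(t_1, ..., t_k) = det (e_i(t_j)). *)
Definition wedge k (e : 'I_k -> diff_form T 1) : diff_form T k := DiffForm (wedge_form e).

Lemma fmul_form k (f : sfun T) (w : diff_form T k) :
  (fun x t => f x * w x t) \in @is_form _ _ _ T k.
Proof.
have /asboolP[wm wa ws] := valP w.
apply/asboolP; split=> [x t i a u v|x t i j ij tij|t].
- by rewrite wm mulrDr mulrCA.
- by rewrite (wa x t i j) // mulr0.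
- exact: (smoothM (sfun_smooth f) (ws t)).
Qed.

Definition fmul k (f : sfun T) (w : diff_form T k) : diff_form T k := DiffForm (fmul_form f w).

Lemma monomial_smooth (a : {ffun 'I_n.+1 -> nat}) :
  smooth (fun x => \prod_i lambda i x ^+ a i).
Proof. by apply: smooth_prod => i; apply: smoothX; exact: sfun_smooth. Qed.

Definition lambda_pow (a : {ffun 'I_n.+1 -> nat}) : sfun T :=
  Sfun (monomial_smooth a).

Definition dlambda k (s : {ffun 'I_k -> 'I_n.+1}) : diff_form T k :=
  wedge (fun j => extd (lambda (s j))).

End Monomials.

Section Indices.
Variable n : nat.

Definition multi_index (r : nat) (a : {ffun 'I_n.+1 -> nat}) : Prop :=
  (\sum_i a i)%N = r.

Definition supp (a : {ffun 'I_n.+1 -> nat}) : {set 'I_n.+1} :=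
  [set i | (0 < a i)%N]%SET.

(* The minimal element of [a]; None stands for infinity. *)
Definition min_index (a : {ffun 'I_n.+1 -> nat}) : option 'I_n.+1 :=
  [pick i | (i \in supp a) && [forall j in supp a, (i <= j)%N]].

Definition increasing k (s : {ffun 'I_k -> 'I_n.+1}) : Prop :=
  forall i j : 'I_k, (i < j)%N -> (s i < s j)%N.

Definition im k (s : {ffun 'I_k -> 'I_n.+1}) : {set 'I_n.+1} :=
  [set s j | j : 'I_k]%SET.

End Indices.

Section Spaces.
Variables (R : realType) (d n : nat) (T : simplex R d n) (r k : nat).

Definition monomial (a : {ffun 'I_n.+1 -> nat}) (s : {ffun 'I_k -> 'I_n.+1}) :
  diff_form T k := fmul (lambda_pow T a) (dlambda T s).

Definition PLambda : set (diff_form T k) :=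
  lin_span [set w | exists a s,
    [/\ multi_index r a, increasing s & w = monomial a s]].

Definition PLambda0 : set (diff_form T k) :=
  [set w | PLambda w /\
    forall m (F : simplex R d m) (sFT : subsimplex F T),
      hull F `<` hull T -> tr sFT w = 0].

Definition BPLambda0 : set (diff_form T k) :=
  [set w | exists a s,
    [/\ multi_index r a, increasing s,
        forall i, min_index a = Some i -> i \notin im s,
        (supp a :|: im s)%SET = [set: 'I_n.+1]%SET & w = monomial a s]].

Definition SPLambda0 : set (diff_form T k) :=
  [set w | exists a s,
    [/\ multi_index r a, increasing s,
        (supp a :|: im s)%SET = [set: 'I_n.+1]%SET & w = monomial a s]].

End Spaces.

Arguments PLambda {R d n} T r k.
Arguments PLambda0 {R d n} T r k.
Arguments BPLambda0 {R d n} T r k.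
Arguments SPLambda0 {R d n} T r k.

(* Main.v *)
Require Import Defs.
From mathcomp Require Import all_boot all_order all_algebra perm.
From mathcomp Require Import boolp classical_sets functions reals normedtype.
From mathcomp Require Import complex.
From mathcomp Require Import fintype finset.

Set Implicit Arguments.
Unset Strict Implicit.
Unset Printing Implicit Defensive.
Import Order.TTheory GRing.Theory Num.Theory.
Local Open Scope ring_scope.

(** Call a monomial lambda^alpha d lambda_sigma of degree r with sigma
    increasing reduced when the least element p of the support of alpha is not
    in the image of sigma, and let its covered set be the union of that support
    and that image.

    Every monomial is a combination of reduced ones with at least the same
    covered set: if p does lie in the image of sigma, replace d lambda_p by
    minus the sum of the other d lambda_j and sort the resulting factors
    ([monomial_reduced]).

    The reduced monomials are linearly independent, even on a face.  Suppose
    that a combination of them vanishes on the face spanned by the vertices in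
    G.  Fix sigma_0 and p outside its image, evaluate on the edge vectors from
    vertex p to the vertices sigma_0(1), ..., sigma_0(k), and let the point run
    through the subface of G spanned by the vertices from p on.  Monomials with
    least index below p vanish at the point; those with least index above p
    have been dealt with by descending induction on p; of those with least
    index p, only those with sigma = sigma_0 do not vanish on the vectors.  What
    is left is a polynomial in the coordinates of the point, and a polynomial
    identity in many variables reduces to one variable by Kronecker's
    substitution ([coefficients_vanish], [face_coefficients_vanish]).

    The theorem follows by using this uniqueness on all faces.  A monomial with
    full covered set has zero trace on every proper face, since such a face
    misses a vertex q, and lambda_q or d lambda_q is a factor
    ([tr_covering_monomial]).  Conversely, expand a form with vanishing traces
    in reduced monomials.  If the covered set G of one of them is not full, the
    trace on the face G vanishes, hence so does its coefficient
    ([PLambda0_sub_span]).  Independence of the basis is the case where G is the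
    whole vertex set. *)

(** * Spans of finite families *)

Section LinearSpans.
Variables (K : pzRingType) (V : lmodType K).
Implicit Types A W : set V.

(** Lets linear combinations be indexed by whatever finite type is at hand,
    so that they can be concatenated and regrouped without arithmetic on
    ordinals. *)
Lemma lin_span_fintype A (I : finType) (b : I -> V) (c : I -> K) :
  (forall i, A (b i)) -> lin_span A (\sum_i c i *: b i).
Proof.
move=> Ab; exists #|I|, (fun i => b (enum_val i)), (fun i => c (enum_val i)).
by split=> [i|]; [exact: Ab | rewrite big_enum_val].
Qed.

Lemma lin_span_mem A w : A w -> lin_span A w.
Proof.
move=> Aw; exists 1%N, (fun=> w), (fun=> 1); split=> //.
by rewrite big_ord1 scale1r.
Qed.

Lemma lin_span0 A : lin_span A 0.
Proof. by exists 0%N, (fun=> 0), (fun=> 0); split=> [[]|]; rewrite ?big_ord0. Qed.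

Lemma lin_spanD A u w : lin_span A u -> lin_span A w -> lin_span A (u + w).
Proof.
move=> [m [b [c [Ab ->]]]] [m' [b' [c' [Ab' ->]]]].
pose B (i : 'I_m + 'I_m') := match i with inl j => b j | inr j => b' j end.
pose C (i : 'I_m + 'I_m') := match i with inl j => c j | inr j => c' j end.
have -> : \sum_i c i *: b i + \sum_i c' i *: b' i = \sum_i C i *: B i.
  by rewrite big_sumType.
by apply: lin_span_fintype => -[].
Qed.

Lemma lin_spanZ A a w : lin_span A w -> lin_span A (a *: w).
Proof.
move=> [m [b [c [Ab ->]]]]; exists m, b, (fun i => a * c i); split=> //.
by rewrite scaler_sumr; apply: eq_bigr => i _; rewrite scalerA.
Qed.

Lemma lin_span_sum A (I : finType) (P : pred I) (F : I -> V) :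
  (forall i, P i -> lin_span A (F i)) -> lin_span A (\sum_(i | P i) F i).
Proof. by move=> AF; apply: big_ind => //; [exact: lin_span0 | exact: lin_spanD]. Qed.

Lemma lin_span_trans A W w :
  (forall u, A u -> lin_span W u) -> lin_span A w -> lin_span W w.
Proof.
move=> AW [m [b [c [Ab ->]]]]; apply: lin_span_sum => i _.
exact/lin_spanZ/AW.
Qed.

(** Collects repeated generators of a family indexed by a finite type, so that
    each index carries a single coefficient. *)
Lemma lin_span_coefficients A (J : finType) (P : pred J) (f : J -> V) w :
  (forall u, A u -> exists2 j, P j & u = f j) -> lin_span A w ->
  exists c : J -> K, w = \sum_(j | P j) c j *: f j.
Proof.
move=> AE [m [b [c [Ab ->]]]].
have /choice[h hP] i : exists j, P j /\ b i = f j.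
  by have [j Pj bE] := AE _ (Ab i); exists j.
exists (fun j => \sum_(i | h i == j) c i).
rewrite (partition_big h P) => [|i _]; last by case: (hP i).
apply: eq_bigr => j _; rewrite scaler_suml.
by apply: eq_bigr => i /eqP<-; rewrite (hP i).2.
Qed.

Lemma linearly_independent_family A (J : finType) (P : pred J) (f : J -> V) :
  (forall u, A u -> exists2 j, P j & u = f j) ->
  (forall c : J -> K, \sum_(j | P j) c j *: f j = 0 -> forall j, P j -> c j = 0) ->
  linearly_independent A.
Proof.
move=> AE indep m b c b_inj Ab sum0 i0.
have /choice[h hP] i : exists j, P j /\ b i = f j.
  by have [j Pj bE] := AE _ (Ab i); exists j.
have h_inj : injective h.
  by move=> i i' hE; apply: b_inj; rewrite (hP i).2 (hP i').2 hE.
have := indep (fun j => \sum_(i | h i == j) c i) _ (h i0) (hP i0).1.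
rewrite (eq_bigl (pred1 i0)) => [|i]; last by rewrite /= (inj_eq h_inj).
rewrite big_pred1_eq; apply; rewrite -[RHS]sum0 [RHS](partition_big h P) => [|i _].
  apply: eq_bigr => j _; rewrite scaler_suml.
  by apply: eq_bigr => i /eqP<-; rewrite (hP i).2.
by case: (hP i).
Qed.

End LinearSpans.

(** * Polynomial identities *)

Section Kronecker.
Variables (N r : nat).

Definition kronecker m (a : nat -> nat) := (\sum_(i < m) a i * r.+1 ^ i)%N.

Lemma kronecker_inj m (a b : nat -> nat) :
  (forall i, a i <= r)%N -> (forall i, b i <= r)%N ->
  kronecker m a = kronecker m b -> forall i, (i < m)%N -> a i = b i.
Proof.
elim: m a b => [|m IH] a b ar br //.
have rec c : kronecker m.+1 c = (kronecker m (fun i => c i.+1) * r.+1 + c 0%N)%N.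
  rewrite /kronecker big_ord_recl muln1 addnC big_distrl /=; congr (_ + _)%N.
  by apply: eq_bigr => i _; rewrite -mulnA -expnSr.
rewrite !rec => kE.
have E0 : a 0%N = b 0%N.
  by have := congr1 (modn^~ r.+1) kE; rewrite !modnMDl !modn_small // ltnS.
case=> [//|i] im; apply: (IH (fun i => a i.+1) (fun i => b i.+1)) => //.
by move/eqP: kE; rewrite E0 eqn_add2r eqn_pmul2r // => /eqP.
Qed.

(** Kronecker substitution y_i = t ^ ((r + 1) ^ i): exponents of size at most r
    are the digits of a number in base r + 1, so distinct monomials become
    distinct powers of t and the one-variable case applies. *)
Lemma polynomial_identity (K : numDomainType) (D : {ffun 'I_N -> 'I_r.+1} -> K) :
  (forall y : 'I_N -> nat, (forall i, 0 < y i)%N ->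
     \sum_a D a * \prod_i (y i)%:R ^+ a i = 0) ->
  forall a, D a = 0.
Proof.
move=> D0 a0.
pose dig (a : {ffun 'I_N -> 'I_r.+1}) i : nat :=
  if insub i is Some j then nat_of_ord (a j) else 0%N.
have digE a (i : 'I_N) : dig a i = a i by rewrite /dig valK.
have dig_r a i : (dig a i <= r)%N by rewrite /dig; case: insub => // j; rewrite -ltnS.
pose w a := kronecker N (dig a).
have w_inj : injective w.
  move=> a b wE; apply/ffunP => i; apply/val_inj; rewrite /= -!digE.
  exact: kronecker_inj wE _ _.
pose q : {poly K} := \sum_a D a *: 'X^(w a).
have q0 : q = 0.
  apply: (@roots_geq_poly_eq0 _ _ [seq t.+1%:R | t <- iota 0 (size q)]).
  - apply/allP => _ /mapP[t _ ->]; apply/rootP.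
    rewrite -[RHS](D0 (fun i : 'I_N => (t.+1 ^ (r.+1 ^ i))%N)) => [|i].
      rewrite horner_sum; apply: eq_bigr => a _.
      rewrite hornerZ hornerXn; congr (_ * _).
      rewrite /w /kronecker -prodrXr; apply: eq_bigr => i _.
      by rewrite natrX -exprM digE mulnC.
    by rewrite expn_gt0.
  - by rewrite map_inj_uniq ?iota_uniq // => t u /eqP; rewrite eqr_nat => /eqP[].
  - by rewrite size_map size_iota.
have := congr1 (fun p : {poly K} => p`_(w a0)) q0.
rewrite coef0 coef_sum (bigD1 a0) //= coefZ coefXn eqxx mulr1 big1 ?addr0 //.
move=> a /negPf aa0.
by rewrite coefZ coefXn (inj_eq w_inj) eq_sym aa0 mulr0.
Qed.

End Kronecker.

(** * Multi-indices and increasing maps *)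

Section Indices.
Variable n : nat.
Implicit Types (a : {ffun 'I_n.+1 -> nat}) (G : {set 'I_n.+1}).

Lemma min_index_some a p : min_index a = Some p ->
  p \in supp a /\ forall i, i \in supp a -> (p <= i)%N.
Proof.
rewrite /min_index; case: pickP => // q /andP[qa /forall_inP qmin] [<-].
by split.
Qed.

Lemma min_index_exists r a : (0 < r)%N -> multi_index r a ->
  exists p, min_index a = Some p.
Proof.
move=> r0 ar; rewrite /min_index; case: pickP => [p _|none]; first by exists p.
have [i ia|supp0] := pickP (fun i => i \in supp a); last first.
  move: r0; rewrite -ar big1 // => i _; apply/eqP.
  by have := supp0 i; rewrite inE lt0n => /negbFE.
have := none [arg min_(j < i in supp a) val j].
by case: arg_minnP => //= j ja jmin; rewrite ja /= => /forall_inP[].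
Qed.

Section Increasing.
Variable k : nat.
Implicit Types s t : {ffun 'I_k -> 'I_n.+1}.

Lemma increasing_inj s : increasing s -> injective s.
Proof.
move=> s_inc i j sE; apply/val_inj.
by case: (ltngtP i j) => [/s_inc|/s_inc|//]; rewrite sE ltnn.
Qed.

Lemma increasing_sorted s : increasing s ->
  sorted ltn [seq val (s i) | i <- enum 'I_k].
Proof.
move=> s_inc; have: sorted ltn (map val (enum 'I_k)).
  by rewrite val_enum_ord iota_ltn_sorted.
rewrite !sorted_map; apply: sub_sorted => i j; exact: s_inc.
Qed.

(** A finite set of naturals has a single increasing enumeration. *)
Lemma increasing_eq s t : increasing s -> increasing t -> im s = im t -> s = t.
Proof.
move=> s_inc t_inc imE.
have mem_im (u : {ffun 'I_k -> 'I_n.+1}) x :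
    (x \in [seq val (u i) | i <- enum 'I_k]) = (x \in [seq val y | y in im u]).
  apply/mapP/imageP => [[i _ ->]|[y /imsetP[i _ ->] ->]]; first by exists (u i); rewrite ?imset_f.
  by exists i; rewrite ?mem_enum.
have E : [seq val (s i) | i <- enum 'I_k] = [seq val (t i) | i <- enum 'I_k].
  apply: (irr_sorted_eq ltn_trans ltnn); [exact: increasing_sorted..|].
  by move=> x; rewrite !mem_im imE.
by apply/ffunP => i; apply/val_inj; move/eq_in_map: E; apply; rewrite mem_enum.
Qed.

Lemma im_card s : injective s -> #|im s| = k.
Proof. by move=> s_inj; rewrite card_imset // card_ord. Qed.

(** Distinct increasing maps have distinct images of equal cardinality, so
    neither image contains the other. *)
Lemma increasing_out s t : increasing s -> increasing t -> s != t ->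
  exists i, s i \notin im t.
Proof.
move=> s_inc t_inc; apply: contra_neqP => /forallNP out.
apply: increasing_eq => //; apply/eqP; rewrite eqEcard; apply/andP; split.
  by apply/subsetP => _ /imsetP[i _ ->]; apply: contra_notT (out i).
by rewrite !im_card //; exact: increasing_inj.
Qed.

Lemma increasing_sort s : injective s ->
  exists t (p : {perm 'I_k}), increasing t /\ forall i, s i = t (p i).
Proof.
move=> s_inj.
have sz := im_card s_inj.
pose t := [ffun i => enum_val (cast_ord (esym sz) i)].
have t_inc : increasing t.
  move=> i j ij; rewrite !ffunE !(enum_val_nth (s i)).
  have srt : sorted (fun x y : 'I_n.+1 => x < y)%N (enum (im s)).
    have -> : enum (im s) = [seq x <- enum 'I_n.+1 | x \in im s] by rewrite enumT.
    apply: sorted_filter => [x y z|]; first exact: ltn_trans.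
    by rewrite -(sorted_map (f := val) (e' := ltn)) val_enum_ord iota_ltn_sorted.
  by apply: (sorted_ltn_nth _ _ srt) => //=; rewrite ?inE -?cardE ?sz //;
    move=> x y z; exact: ltn_trans.
have /choice[p pE] i : exists j, s i = t j.
  have si : s i \in im s by rewrite imset_f.
  exists (cast_ord sz (enum_rank_in si (s i))).
  by rewrite ffunE cast_ordK enum_rankK_in.
have p_inj : injective p by move=> i j pij; apply: s_inj; rewrite !pE pij.
by exists t, (perm p_inj); split=> // i; rewrite permE.
Qed.

End Increasing.
End Indices.

(** * Uniqueness of coefficients in coordinates *)

Section Uniqueness.
Variables (K : numDomainType) (n k r : nat).

Implicit Types s e : {ffun 'I_k -> 'I_n.+1}.

(** Exponents are bounded by the degree, so the pairs (alpha, sigma) of degree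
    r are found in this finite type. *)
Definition mono_index := ({ffun 'I_n.+1 -> 'I_r.+1} * {ffun 'I_k -> 'I_n.+1})%type.
Definition exponent (j : mono_index) : {ffun 'I_n.+1 -> nat} :=
  [ffun i => nat_of_ord (j.1 i)].
Definition covered (j : mono_index) : {set 'I_n.+1} := supp (exponent j) :|: im j.2.
Definition reduced (j : mono_index) : bool :=
  `[< [/\ multi_index r (exponent j), increasing j.2
        & forall i, min_index (exponent j) = Some i -> i \notin im j.2] >].

(** The matrix of d lambda_(s i) on the edge vectors from p to e l. *)
Definition edge_matrix s e (p : 'I_n.+1) : 'M[K]_k :=
  \matrix_(i, l) ((s i == e l)%:R - (s i == p)%:R).

(** A row of zeros: the vertex s i is an end of none of the edges. *)
Lemma edge_matrix_out s e p i : s i \notin im e -> s i != p ->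
  \det (edge_matrix s e p) = 0.
Proof.
move=> sie /negPf sip; rewrite (expand_det_row _ i) big1 // => l _.
rewrite mxE sip subr0 (_ : (_ == _) = false) ?mul0r //.
by apply: contraNF sie => /eqP->; rewrite imset_f.
Qed.

Lemma edge_matrix_id s p : injective s -> p \notin im s ->
  \det (edge_matrix s s p) = 1.
Proof.
move=> s_inj ps; rewrite -(det1 K k); congr (\det _); apply/matrixP => i l.
rewrite !mxE (inj_eq s_inj) (_ : (s i == p) = false) ?subr0 //.
by apply: contraNF ps => /eqP<-; rewrite imset_f.
Qed.

(** The coordinate form of the uniqueness statement: y are the coordinates of a
    point up to scaling, and the vectors are edges of the face G with common
    origin p. *)
Lemma coefficients_vanish (G : {set 'I_n.+1}) (C : mono_index -> K) : (0 < r)%N ->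
  (forall (y : 'I_n.+1 -> nat) (e : {ffun 'I_k -> 'I_n.+1}) p,
     (forall i, i \notin G -> y i = 0%N) -> (0 < y p)%N ->
     im e \subset G -> p \in G ->
     \sum_(j | reduced j) C j *
       ((\prod_i (y i)%:R ^+ exponent j i) * \det (edge_matrix j.2 e p)) = 0) ->
  forall j, reduced j -> covered j \subset G -> C j = 0.
Proof.
move=> r0 sum0 j0 red0; have /asboolP[deg0 _ _] := red0.
have [p pE] := min_index_exists r0 deg0.
(* Descending induction on the least index p of the exponent. *)
have [m] := ubnP (n - p); elim: m j0 red0 deg0 p pE => // m IH.
move=> [a0 s0] red0 deg0 p pE; rewrite ltnS => pm.
have /asboolP[_ /= inc0 /(_ p pE) ps0] := red0.
rewrite /covered subUset => /andP[/= supG s0G].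
have [psup _] := min_index_some pE.
have pG := subsetP supG p psup.
(* The points are taken in H, the part of G from p on; what survives of the sum
   there is the polynomial with the coefficients D. *)
pose H := [set i in G | p <= i]%N.
have pH : p \in H by rewrite inE pG leqnn.
pose D a : K := if reduced (a, s0) && (supp (exponent (a, s0)) \subset H)
  then C (a, s0) else 0.
suff /(_ a0) : forall a, D a = 0.
  rewrite /D red0 ifT //; apply/subsetP => i ia.
  by rewrite inE (subsetP supG) //= (min_index_some pE).2.
apply: polynomial_identity => y y0.
pose yH i := if i \in H then y i else 0%N.
rewrite -[RHS](sum0 yH s0 p) //; first last.
- by rewrite /yH pH.
- by move=> i iG; rewrite /yH inE (negPf iG).
have supp0 a : ~~ (supp (exponent a) \subset H) ->
    \prod_i (yH i)%:R ^+ exponent a i = 0 :> K.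
  move=> /subsetPn[i ia iH]; rewrite (bigD1 i) //= /yH (negPf iH).
  by move: ia; rewrite inE expr0n lt0n => /negPf->; rewrite mul0r.
have suppH a : supp (exponent a) \subset H ->
    \prod_i (yH i)%:R ^+ exponent a i = \prod_i (y i)%:R ^+ a.1 i :> K.
  move=> aH; apply: eq_bigr => i _; rewrite ffunE /yH; case: ifPn => // iH.
  suff -> : nat_of_ord (a.1 i) = 0%N by rewrite !expr0.
  apply/eqP; apply: contraNT iH => ai; apply: (subsetP aH).
  by rewrite inE ffunE lt0n.
rewrite (bigID (fun j => j.2 == s0)) /= [X in _ = _ + X]big1 ?addr0.
  transitivity (\sum_a \sum_(s | reduced (a, s0) && (s == s0)) C (a, s) *
      (\prod_i (yH i)%:R ^+ exponent (a, s) i * \det (edge_matrix s s0 p))).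
    2: rewrite pair_big_dep /=; apply: eq_big => [[a s]|[a s] _] //=.
    2: by case: eqP => [->|_]; rewrite ?andbF.
  apply: eq_bigr => a _; rewrite /D.
  case red: (reduced _) => /=; last by rewrite big_pred0_eq mul0r.
  rewrite big_pred1_eq edge_matrix_id ?mulr1 //; last exact: increasing_inj.
  case: ifPn => [aH|aH]; first by rewrite suppH.
  by rewrite supp0 // mulr0 mul0r.
move=> [a s] /= /andP[red ss0]; have /asboolP[/= deg inc fl] := red.
have [aH|aH] := boolP (supp (exponent (a, s)) \subset H); last first.
  by rewrite supp0 // mul0r mulr0.
have [q qE] := min_index_exists r0 deg.
have [/(subsetP aH) qH _] := min_index_some qE.
move: qH; rewrite inE => /andP[qG]; rewrite leq_eqVlt => /orP[/eqP pq|pq].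
  (* The least index is p: some factor of d lambda_sigma is zero on all the
     edges, because it is neither one of sigma_0 nor p. *)
  have [i si] := increasing_out inc inc0 ss0.
  rewrite (edge_matrix_out si) ?mulr0 //.
  by apply: contraNneq (fl _ qE) => sip; rewrite -(val_inj pq) -sip imset_f.
(* The least index exceeds p: either the induction hypothesis applies, or a
   factor of d lambda_sigma is zero on the face G. *)
have [sG|/subsetPn[_ /imsetP[i _ ->] iG]] := boolP (im s \subset G).
  rewrite (IH (a, s) red deg q qE) ?mul0r //.
    apply: leq_trans pm; rewrite ltn_sub2l //.
    by apply: leq_trans pq _; rewrite -ltnS.
  rewrite /covered subUset sG andbT; apply: subset_trans aH _.
  by apply/subsetP => i; rewrite inE => /andP[].
rewrite (edge_matrix_out (i := i)) ?mulr0 //.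
  by apply: contraNN iG; exact: (subsetP s0G).
by apply: contraNneq iG => ->.
Qed.

End Uniqueness.

(** * Values of monomials *)

Section Values.
Variables (R : realType) (d n : nat) (T : simplex R d n).

Lemma hull_point (c : 'I_n.+1 -> R) : (forall i, 0 <= c i) -> \sum_i c i = 1 ->
  exists x : hull T, val x = \sum_i c i *: T i.
Proof.
move=> c0 c1; have Tx : hull T (\sum_i c i *: T i) by exists c.
by exists (SigSub (mem_set Tx)).
Qed.

Lemma tangent_combination (c : 'I_n.+1 -> R) : \sum_i c i = 0 ->
  \sum_i c i *: T i = \sum_i c i *: (T i - T ord0).
Proof.
move=> c0; under [RHS]eq_bigr do rewrite scalerBr.
by rewrite sumrB -scaler_suml c0 scale0r subr0.
Qed.

(** Tangent vectors have barycentric coordinates too, of sum zero instead of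
    one, and d lambda_j reads off the j-th one.  All computations with forms
    below go through these coordinates. *)
Lemma extd_lambda j x (t : 'I_1 -> tvec T) (c : 'I_n.+1 -> R) :
  \sum_i c i = 0 -> vsval (t ord0) = \sum_i c i *: T i ->
  extd (lambda T j) x t = (c j)%:C%C.
Proof.
move=> c0 tE; have [l [l_lin lE]] := barycentric_differential T j.
have ll : real_linear (fun s : tvec T => (l s)%:C%C).
  by move=> a s s'; rewrite l_lin realcD realcM.
have dl : is_differential (lambda T j) x (fun s => (l s)%:C%C).
  split=> // e e0; exists 1 => // y _.
  by rewrite -lE rmorphB subrr normr0 ler0c mulr_ge0 // ltW.
rewrite /= (is_differential_unique (differentialP x (sfun_smooth _)) dl).
have -> : t ord0 = \sum_i c i *: vsproj (tangent T) (T i - T ord0).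
  apply: val_inj; rewrite /= tE tangent_combination // linear_sum /=.
  by apply: eq_bigr => i _; rewrite vsprojK ?tangent_vertex.
rewrite (real_linear_sum _ _ ll) (bigID (pred1 j)) /= big_pred1_eq.
have lv i : l (vsproj (tangent T) (T i - T ord0)) = (j == i)%:R - (j == ord0)%:R.
  rewrite -(lE (vertex_point T ord0) (vertex_point T i)).
  by have [_ bv] := barycentricP T j; rewrite !bv.
under eq_bigr => i ij.
  rewrite (real_linearZ _ _ ll) lv eq_sym (negPf ij) sub0r -realcM; over.
rewrite (real_linearZ _ _ ll) lv eqxx -realcM -rmorph_sum -rmorphD.
rewrite -mulr_suml mulrBr mulr1 mulrN addrAC -addrA -opprD -mulrDl.
move: c0; rewrite (bigD1 j) //= addrC => /eqP; rewrite addr_eq0 => /eqP->.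
by rewrite addNr mul0r subr0.
Qed.

Lemma extd_lambda_sum x t : \sum_j extd (lambda T j) x t = 0.
Proof.
have [c [c0 tE]] := tangent_coords (t ord0).
under eq_bigr do rewrite (extd_lambda _ _ c0 tE).
by rewrite -rmorph_sum c0.
Qed.

Variable k : nat.

Lemma form_sum (I : finType) (P : pred I) (c : I -> R[i]) (w : I -> diff_form T k)
    x t :
  (\sum_(i | P i) c i *: w i) x t = \sum_(i | P i) c i * w i x t.
Proof.
by apply: (big_morph (fun v : diff_form T k => v x t)).
Qed.

Lemma monomialE a (s : {ffun 'I_k -> 'I_n.+1}) x t : monomial T a s x t =
  (\prod_i lambda T i x ^+ a i) *
  \det (\matrix_(i, l) extd (lambda T (s i)) x (fun=> t l)).
Proof. by []. Qed.

Lemma monomial_value a (s : {ffun 'I_k -> 'I_n.+1}) x t c (u : 'I_k -> 'I_n.+1 -> R) :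
  \sum_i c i = 1 -> val x = \sum_i c i *: T i ->
  (forall l, \sum_i u l i = 0) -> (forall l, vsval (t l) = \sum_i u l i *: T i) ->
  monomial T a s x t =
  (\prod_i (c i)%:C%C ^+ a i) * \det (\matrix_(i, l) (u l (s i))%:C%C).
Proof.
move=> c1 xE u0 tE; rewrite monomialE; congr (_ * _).
  by apply: eq_bigr => i _; rewrite /= (barycentricE i c1 xE).
by congr (\det _); apply/matrixP => i l; rewrite !mxE; exact: extd_lambda.
Qed.

End Values.

(** * Exchanging a factor *)

Lemma expand_det_row_replaced (K : comPzRingType) k (A B : 'M[K]_k) i0 :
  (forall i l, i != i0 -> A i l = B i l) ->
  \det A = \sum_l A i0 l * cofactor B i0 l.
Proof.
move=> AB; rewrite (expand_det_row _ i0); apply: eq_bigr => l _.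
congr (_ * (_ * \det _)); apply/matrixP => i l'.
by rewrite !mxE AB // eq_sym neq_lift.
Qed.

Section Exchange.
Variables (R : realType) (d n : nat) (T : simplex R d n) (r k : nat).
Implicit Types (a : {ffun 'I_n.+1 -> nat}) (s : {ffun 'I_k -> 'I_n.+1}).
Implicit Types W : {set 'I_n.+1}.

Definition replace s i0 j : {ffun 'I_k -> 'I_n.+1} :=
  [ffun i => if i == i0 then j else s i].

(** The determinant is linear in its row i0, and the d lambda_j add up to
    zero. *)
Lemma monomial_replace_sum a s i0 : \sum_j monomial T a (replace s i0 j) = 0.
Proof.
apply/val_inj/funext => x; apply/funext => t.
under eq_bigr do rewrite -[monomial _ _ _]scale1r.
rewrite [LHS](form_sum xpredT (fun=> 1)).
under eq_bigr do rewrite mul1r monomialE.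
rewrite -mulr_sumr [X in _ * X](_ : _ = 0) ?mulr0 //.
pose A := \matrix_(i, l) extd (lambda T (s i)) x (fun=> t l).
under eq_bigr => j _.
  rewrite (expand_det_row_replaced (B := A) (i0 := i0)) => [|i l /negPf ii0].
    under eq_bigr do rewrite mxE ffunE eqxx.
    over.
  by rewrite !mxE ffunE ii0.
rewrite exchange_big big1 // => l _.
by rewrite -mulr_suml extd_lambda_sum mul0r.
Qed.

Lemma monomial_not_inj a s : ~ injective s -> monomial T a s = 0.
Proof.
move=> /injectiveP/injectivePn[i [i' ii' sE]].
apply/val_inj/funext => x; apply/funext => t.
rewrite [LHS]monomialE (determinant_alternate ii') ?mulr0 // => l.
by rewrite !mxE sE.
Qed.

Lemma monomial_perm a s s' (p : {perm 'I_k}) : (forall i, s i = s' (p i)) ->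
  monomial T a s = (-1) ^+ p *: monomial T a s'.
Proof.
move=> sE; apply/val_inj/funext => x; apply/funext => t.
rewrite [LHS]monomialE [RHS](_ : _ = (-1) ^+ p * monomial T a s' x t) //.
rewrite monomialE mulrCA; congr (_ * _).
rewrite -det_perm -det_mulmx -row_permE; congr (\det _).
by apply/matrixP => i l; rewrite !mxE sE.
Qed.

Definition reduced_monomials W : set (diff_form T k) :=
  fun w => exists a s,
    [/\ multi_index r a, increasing s,
        forall i, min_index a = Some i -> i \notin im s,
        W \subset supp a :|: im s & w = monomial T a s].

(** If p, the least element of the support of alpha, lies in the image of
    sigma, then d lambda_p is traded for the other d lambda_j.  One exchange
    suffices, as alpha does not change; the covered set can only grow, since p
    stays in the support of alpha. *)
Lemma monomial_reduced W a s : (0 < r)%N -> multi_index r a -> increasing s ->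
  W \subset supp a :|: im s ->
  lin_span (reduced_monomials W) (monomial T a s).
Proof.
move=> r0 deg inc Was; have [p pE] := min_index_exists r0 deg.
have [psup _] := min_index_some pE.
have [/imsetP[i0 _ pi0]|ps] := boolP (p \in im s); last first.
  by apply: lin_span_mem; exists a, s; split=> // i; rewrite pE => -[<-].
have repl_p : replace s i0 p = s.
  by apply/ffunP => i; rewrite ffunE; case: eqP => // ->.
have := monomial_replace_sum a s i0.
rewrite (bigD1 p) //= repl_p => /eqP; rewrite addr_eq0 => /eqP->.
rewrite -scaleN1r; apply/lin_spanZ/lin_span_sum => j jp.
have [inj|/monomial_not_inj->] := pselect (injective (replace s i0 j)); last first.
  exact: lin_span0.
have [s' [q [inc' sE]]] := increasing_sort inj.
have imE : im s' = im (replace s i0 j).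
  apply/setP => i; apply/imsetP/imsetP => -[l _ ->].
    by exists (perm.perm_inv q l); rewrite // sE permKV.
  by exists (q l); rewrite // sE.
rewrite (monomial_perm _ sE); apply/lin_spanZ/lin_span_mem.
exists a, s'; split=> //.
  move=> i; rewrite pE imE => -[<-]; apply/imsetP => -[l _].
  rewrite ffunE; case: eqP => [_ pj|li pl]; first by rewrite pj eqxx in jp.
  by apply/li/(increasing_inj inc); rewrite -pl.
apply: subset_trans Was _; rewrite imE; apply/subsetP => i.
rewrite !inE => /orP[->//|/imsetP[l _ ->]].
have [->|li] := eqVneq l i0.
  by rewrite -pi0; move: psup; rewrite inE => ->.
by apply/orP; right; apply/imsetP; exists l; rewrite // ffunE (negPf li).
Qed.

End Exchange.

Arguments reduced_monomials {R d n} T r k W.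

(** * Uniqueness of coefficients on a face *)

Section Vanishing.
Variables (R : realType) (d n : nat) (T : simplex R d n) (r k : nat).

(** Uniqueness of coefficients for forms: if the pullback to the face spanned by
    the vertices in G vanishes, then so do the coefficients of all reduced
    monomials living on that face.  The monomials have degree r in the
    coordinates of the point, so the points with natural coordinates used in
    [coefficients_vanish] may be scaled into the simplex. *)
Lemma face_coefficients_vanish (G : {set 'I_n.+1}) (C : mono_index n k r -> R[i]) :
  (0 < r)%N ->
  (forall (x : hull T) (t : 'I_k -> tvec T) c (u : 'I_k -> 'I_n.+1 -> R),
     (forall i, 0 <= c i) -> \sum_i c i = 1 -> (forall i, i \notin G -> c i = 0) ->
     val x = \sum_i c i *: T i ->
     (forall l, \sum_i u l i = 0) -> (forall l i, i \notin G -> u l i = 0) ->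
     (forall l, vsval (t l) = \sum_i u l i *: T i) ->
     (\sum_(j | reduced j) C j *: monomial T (exponent j) j.2) x t = 0) ->
  forall j, reduced j -> covered j \subset G -> C j = 0.
Proof.
move=> r0 sum0; apply: coefficients_vanish => // y e p yG yp eG pG.
pose S : R := \sum_i (y i)%:R.
have S0 : 0 < S.
  by rewrite /S (bigD1 p) //= ltr_pwDl ?ltr0n ?sumr_ge0.
pose c i : R := (y i)%:R / S.
have c0 i : 0 <= c i by rewrite divr_ge0 // ltW.
have c1 : \sum_i c i = 1 by rewrite -mulr_suml divff // gt_eqF.
have [x xE] := hull_point T c0 c1.
pose u l i : R := (i == e l)%:R - (i == p)%:R.
have delta_sum (q : 'I_n.+1) (f : 'I_n.+1 -> 'rV[R]_d) :
    \sum_i (i == q)%:R *: f i = f q.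
  rewrite (bigD1 q) //= eqxx scale1r big1 ?addr0 // => i /negPf->.
  by rewrite scale0r.
have u0 l : \sum_i u l i = 0.
  rewrite sumrB (bigD1 (e l)) //= eqxx big1 => [|i /negPf->//].
  by rewrite (bigD1 p) //= eqxx big1 ?subrr // => i /negPf->.
pose t l := vsproj (tangent T) (T (e l) - T p).
have tE l : vsval (t l) = \sum_i u l i *: T i.
  rewrite vsprojK ?tangent_vertex //.
  by under eq_bigr do rewrite scalerBl; rewrite sumrB !delta_sum.
have cG i : i \notin G -> c i = 0 by move=> iG; rewrite /c yG // mul0r.
have uG l i : i \notin G -> u l i = 0.
  move=> iG; have out q : q \in G -> (i == q) = false.
    by move=> qG; apply: contraNF iG => /eqP->.
  by rewrite /u !out ?subrr // (subsetP eG) ?imset_f.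
have E := sum0 x t c u c0 c1 cG xE u0 uG tE.
apply: etrans (mulr0 (S%:C%C ^+ r)); rewrite -[X in _ = _ * X]E form_sum.
rewrite mulr_sumr; apply: eq_bigr => j /asboolP[deg _ _].
have DE : \matrix_(i, l) (u l (j.2 i))%:C%C = edge_matrix _ j.2 e p.
  by apply/matrixP => i l; rewrite !mxE /u rmorphB !rmorph_nat.
suff PE : \prod_i (y i)%:R ^+ exponent j i =
    S%:C%C ^+ r * \prod_i (c i)%:C%C ^+ exponent j i :> R[i].
  rewrite (monomial_value _ _ c1 xE u0 tE) DE PE.
  have AC (z1 z2 z3 z4 : R[i]) : z1 * ((z2 * z3) * z4) = z2 * (z1 * (z3 * z4)).
    by rewrite -mulrA mulrCA.
  exact: AC.
rewrite -[X in _ ^+ X]deg -prodrXr -big_split /=; apply: eq_bigr => i _.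
rewrite -exprMn -realcM /c mulrCA divff ?gt_eqF // mulr1.
by congr (_ ^+ _); rewrite rmorph_nat.
Qed.

End Vanishing.

(** * Traces *)

Section Traces.
Variables (R : realType) (d n : nat) (T : simplex R d n) (k : nat).

Lemma pushforward_sum m (h : 'I_m -> 'I_n.+1) (c : 'I_m -> R) :
  \sum_j \sum_(i | h i == j) c i = \sum_i c i.
Proof. by rewrite [RHS](partition_big h predT). Qed.

Lemma pushforward_combination m (h : 'I_m -> 'I_n.+1) (c : 'I_m -> R) :
  \sum_i c i *: T (h i) = \sum_j (\sum_(i | h i == j) c i) *: T j.
Proof.
rewrite (partition_big h predT) //=; apply: eq_bigr => j _.
by rewrite scaler_suml; apply: eq_bigr => i /eqP->.
Qed.

Lemma tr_combination m (F : simplex R d m) (sFT : subsimplex F T) (I : finType)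
    (c : I -> R[i]) (w : I -> diff_form T k) :
  tr sFT (\sum_i c i *: w i) = \sum_i c i *: tr sFT (w i).
Proof.
by apply/val_inj/funext => x; apply/funext => t; rewrite [RHS]form_sum [LHS]form_sum.
Qed.

(** A proper subsimplex misses a vertex q, and both lambda_q and d lambda_q
    vanish on it; one of the two occurs in the monomial. *)
Lemma tr_covering_monomial m (F : simplex R d m) (sFT : subsimplex F T) a
    (s : {ffun 'I_k -> 'I_n.+1}) :
  (hull F `<` hull T)%classic -> supp a :|: im s = [set: 'I_n.+1] ->
  tr sFT (monomial T a s) = 0.
Proof.
move=> [_ TF] cov; have [h hE] := choice sFT.
have [q qh] : exists q, forall i, h i != q.
  apply: contrapT => /forallNP all_hit; apply: TF; apply: subsimplex_hull => j.
  have /existsNP[i /negP] := all_hit j.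
  by rewrite negbK => /eqP<-; exists i; rewrite hE.
have push_q (c : 'I_m.+1 -> R) : \sum_(i | h i == q) c i = 0.
  by apply: big_pred0 => i; apply: negPf.
apply/val_inj/funext => x; apply/funext => t.
have [c [_ c1 xE]] := set_valP x.
have /choice[u uP] l := tangent_coords (t l).
have {}xE : val x = \sum_j (\sum_(i | h i == j) c i) *: T j.
  by rewrite xE -pushforward_combination; apply: eq_bigr => i _; rewrite hE.
have tE l : vsval (incl_vec sFT (t l)) = \sum_j (\sum_(i | h i == j) u l i) *: T j.
  by rewrite /= (uP l).2 -pushforward_combination; apply: eq_bigr => i _; rewrite hE.
rewrite [LHS](monomial_value a s _ _ _ tE (x := incl_point sFT x)
    (c := fun j => \sum_(i | h i == j) c i)) //; first last.
- by move=> l; rewrite pushforward_sum (uP l).1.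
- by rewrite pushforward_sum.
have: q \in supp a :|: im s by rewrite cov inE.
rewrite !inE => /orP[aq|/imsetP[i _ qE]].
  by rewrite (bigD1 q) //= push_q rmorph0 expr0n -[_ == _]negbK -lt0n aq !mul0r.
rewrite (expand_det_row _ i) [X in _ * X]big1 ?mulr0 // => l _.
by rewrite mxE -qE push_q rmorph0 mul0r.
Qed.

Lemma face_sum (G : {set 'I_n.+1}) m (h : 'I_m -> 'I_n.+1) (V : zmodType)
    (f : 'I_n.+1 -> V) :
  injective h -> h @: setT = G -> (forall j, j \notin G -> f j = 0) ->
  \sum_i f (h i) = \sum_j f j.
Proof.
move=> h_inj hG f0; rewrite [RHS](bigID (mem G)) /= [X in _ = _ + X]big1 // addr0.
rewrite -hG big_imset /=; last by move=> i j _ _; exact: h_inj.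
by apply: eq_bigl => i; rewrite inE.
Qed.

Lemma face_exists (G : {set 'I_n.+1}) : (0 < #|G|)%N ->
  exists m (F : simplex R d m) (h : 'I_m.+1 -> 'I_n.+1),
    [/\ injective h, h @: setT = G & forall i, F i = T (h i)].
Proof.
move=> G0; have Gm : #|G|.-1.+1 = #|G| by rewrite prednK.
pose h (i : 'I_#|G|.-1.+1) := enum_val (cast_ord Gm i).
have h_inj : injective h by move=> i j /enum_val_inj/cast_ord_inj.
have Fi : affinely_independent (fun i => T (h i)).
  move=> c c0; rewrite pushforward_combination => cT i.
  rewrite -(vertex_indep (s := T) _ cT (h i)) ?pushforward_sum //.
  by rewrite (eq_bigl (pred1 i)) ?big_pred1_eq // => j; rewrite (inj_eq h_inj).
exists #|G|.-1, (Simplex Fi), h; split=> //.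
apply/setP => q; apply/imsetP/idP => [[i _ ->]|qG]; first exact: enum_valP.
exists (cast_ord (esym Gm) (enum_rank_in qG q)) => //.
by rewrite /h cast_ordKV enum_rankK_in.
Qed.

(** A form is tested on a face by points and vectors of the ambient simplex
    with coordinates supported on that face. *)
Lemma tr_eq0_on_face (G : {set 'I_n.+1}) (w : diff_form T k) :
  (0 < #|G|)%N -> G != [set: 'I_n.+1] ->
  (forall m (F : simplex R d m) (sFT : subsimplex F T),
     (hull F `<` hull T)%classic -> tr sFT w = 0) ->
  forall (x : hull T) (t : 'I_k -> tvec T) c (u : 'I_k -> 'I_n.+1 -> R),
    (forall i, 0 <= c i) -> \sum_i c i = 1 -> (forall i, i \notin G -> c i = 0) ->
    val x = \sum_i c i *: T i ->
    (forall l, \sum_i u l i = 0) -> (forall l i, i \notin G -> u l i = 0) ->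
    (forall l, vsval (t l) = \sum_i u l i *: T i) ->
    w x t = 0.
Proof.
move=> G0 GT trw x t c u c0 c1 cG xE u0 uG tE.
have [m [F [h [h_inj hG hE]]]] := face_exists G0.
have sFT : subsimplex F T by move=> i; exists (h i).
have proper_face : (hull F `<` hull T)%classic.
  split; first exact: subsimplex_hull.
  have [q qG] : exists q, q \notin G.
    by apply/existsP; rewrite -negb_forall; apply: contraNN GT => /forallP GE;
      apply/eqP/setP => q; rewrite GE inE.
  move=> /(_ _ (hull_vertex T q))[b [_ b1 qE]].
  have bE := @barycentricE _ _ _ T q (fun j => \sum_(i | h i == j) b i)
    (vertex_point T q).
  have := (barycentricP T q).2 q; rewrite eqxx bE ?pushforward_sum //; last first.
    by rewrite -pushforward_combination /= qE; apply: eq_bigr => i _; rewrite hE.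
  rewrite big_pred0 => [/esym/eqP|i]; first by rewrite oner_eq0.
  by apply: contraNF qG => /eqP<-; rewrite -hG imset_f.
have [|x' x'E] := @hull_point _ _ _ F (c \o h) (fun i => c0 (h i)).
  by rewrite (face_sum h_inj hG).
have FE (b : 'I_n.+1 -> R) : (forall i, i \notin G -> b i = 0) ->
    \sum_i b (h i) *: F i = \sum_i b i *: T i.
  move=> bG; rewrite -(face_sum h_inj hG (f := fun i => b i *: T i)).
    by apply: eq_bigr => i _; rewrite hE.
  by move=> i iG; rewrite bG // scale0r.
have tF l : vsval (t l) \in tangent F.
  rewrite tE -(FE _ (uG l)) tangent_combination ?(face_sum h_inj hG) //; last exact: uG.
  by apply: memv_suml => i _; rewrite memvZ // tangent_vertex.
transitivity (tr sFT w x' (fun l => Subvs (tF l))); last first.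
  by rewrite (trw _ _ _ proper_face).
rewrite /tr /= /pullback; congr (w _ _).
  by apply: val_inj; rewrite /= x'E xE FE.
by apply/funext => l; apply: val_inj.
Qed.

End Traces.

(** * The basis *)

Section Basis.
Variables (R : realType) (d n : nat) (T : simplex R d n) (k r : nat).

Let mono (j : mono_index n k r) := monomial T (exponent j) j.2.

Lemma reduced_monomials_family W w : reduced_monomials T r k W w ->
  exists2 j : mono_index n k r, reduced j && (W \subset covered j) & w = mono j.
Proof.
move=> [a [s [deg inc red Was wE]]].
pose j : mono_index n k r := ([ffun i => inord (a i)], s).
have aE : exponent j = a.
  apply/ffunP => i; rewrite !ffunE /= inordK // ltnS.
  by rewrite -[leqRHS]deg (bigD1 i) //= leq_addr.
exists j; last by rewrite /mono aE.
by rewrite /covered aE Was andbT; apply/asboolP; rewrite aE.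
Qed.

Lemma reduced_monomials_full :
  reduced_monomials T r k [set: 'I_n.+1] = BPLambda0 T r k.
Proof.
apply/funext => w; apply/propext.
split=> -[a [s [deg inc red cov ->]]]; exists a, s; split=> //.
  by apply/eqP; rewrite -subTset.
by rewrite cov.
Qed.

Lemma BPLambda0_independent : (0 < r)%N ->
  linearly_independent (BPLambda0 T r k).
Proof.
move=> r_gt0; rewrite -reduced_monomials_full.
apply: (linearly_independent_family (reduced_monomials_family (W := setT))).
move=> C C0 j /andP[redj cov].
pose D i := if [set: 'I_n.+1] \subset covered i then C i else 0.
have D0 : \sum_(i | reduced i) D i *: mono i = 0.
  rewrite -[RHS]C0 [RHS]big_mkcondr; apply: eq_bigr => i _.
  by rewrite /D; case: ifP => //; rewrite scale0r.
suff : D j = 0 by rewrite /D cov.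
apply: (face_coefficients_vanish (T := T) (G := setT) r_gt0 _ redj (subsetT _)).
by move=> x t *; rewrite [X in diff_form_val X _ _]D0.
Qed.

(** A reduced monomial whose covered set is not full has coefficient zero,
    because the form has zero trace on the face spanned by that set. *)
Lemma PLambda0_sub_span w : (0 < r)%N ->
  PLambda0 T r k w -> lin_span (BPLambda0 T r k) w.
Proof.
move=> r_gt0 [Pw trw].
have {Pw} : lin_span (reduced_monomials T r k set0) w.
  apply: lin_span_trans Pw => _ [a [s [deg inc ->]]].
  by apply: monomial_reduced; rewrite ?sub0set.
move=> /(lin_span_coefficients (reduced_monomials_family (W := set0)))[C wE].
have {}wE : w = \sum_(j | reduced j) C j *: mono j.
  by rewrite wE; apply: eq_bigl => j; rewrite sub0set andbT.
rewrite [w]wE; apply: lin_span_sum => j redj.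
have /asboolP[deg inc red] := redj.
have [cov|ncov] := eqVneq (covered j) [set: 'I_n.+1].
  by apply/lin_spanZ/lin_span_mem; exists (exponent j), j.2.
rewrite (_ : C j = 0) ?scale0r; first exact: lin_span0.
apply: (face_coefficients_vanish (G := covered j) r_gt0 _ redj (subxx _)).
move=> x t c u c0 c1 cG xE u0 uG tE.
have [p /min_index_some[psup _]] := min_index_exists r_gt0 deg.
have G0 : (0 < #|covered j|)%N by apply/card_gt0P; exists p; rewrite inE psup.
by have := tr_eq0_on_face G0 ncov trw c0 c1 cG xE u0 uG tE; rewrite wE.
Qed.

(** Handles the basis and the larger spanning set at once. *)
Lemma spans_PLambda0 A : (0 < r)%N ->
  (BPLambda0 T r k `<=` A)%classic -> (A `<=` SPLambda0 T r k)%classic ->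
  spanning_set A (PLambda0 T r k).
Proof.
move=> r_gt0 BA AS; apply/funext => w; apply/propext; split.
  move=> Aw; split.
    apply: lin_span_trans Aw => _ /AS[a [s [deg inc cov ->]]].
    by apply: lin_span_mem; exists a, s.
  move=> m F sFT FT; have [N [b [c [Ab ->]]]] := Aw.
  rewrite tr_combination big1 // => i _.
  have [a [s [_ _ cov ->]]] := AS _ (Ab i).
  by rewrite tr_covering_monomial ?scaler0.
move=> /(PLambda0_sub_span r_gt0); apply: lin_span_trans => v Bv.
exact/lin_span_mem/BA.
Qed.

End Basis.

Theorem theorem4p2 (R : realType) (d n : nat) (T : simplex R d n) (k r : nat)
    (hk : (k <= n)%N) (hr : (1 <= r)%N) :
  is_basis (BPLambda0 T r k) (PLambda0 T r k) /\
  spanning_set (SPLambda0 T r k) (PLambda0 T r k).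
Proof.
have BS : (BPLambda0 T r k `<=` SPLambda0 T r k)%classic.
  by move=> w [a [s [deg inc _ cov ->]]]; exists a, s.
split; first split.
- exact: BPLambda0_independent.
- exact: spans_PLambda0.
- exact: spans_PLambda0.
Qed.
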